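(* Let $X$ be a set and $h_i:X\to\mathbb{R}$, $i=1,\dots,r$, fixed functions such that for any $t_i\in h_i(X)$, $i=1,\dots,r$, the system of equations $h_i(x)=t_i$, $i=1,\dots,r$, has at least one solution $x\in X$. Let $Q\subset X$. Then $Q$ is a complete representation set if and only if $Q$ is a unicity set; that is, if and only if for any $x_0\in Q$, any function $f:Q\to\mathbb{R}$ and any $a_1,\dots,a_{r-1}\in\mathbb{R}$, the representation $$f(x)=\sum_{i=1}^rg_i(h_i(x)),\qquad x\in Q,$$ subject to the conditions $g_i(h_i(x_0))=a_i$, $i=1,\dots,r-1$, exists and is unique (uniqueness meaning that the functions $g_i$ are uniquely determined on the sets $h_i(Q)$, $i=1,\dots,r$).
   Context: A set $Q\subset X$ is a representation set if every function $f:Q\to\mathbb{R}$ can be written as $f(x)=\sum_{i=1}^rg_i(h_i(x))$, $x\in Q$, with some functions $g_i:\mathbb{R}\to\mathbb{R}$. A set $Q\subset X$ is a complete representation set if $Q$ is a representation set and there is no other representation set $P\subset X$, $P\ne Q$, such that $Q\subset P$ and $h_i(P)=h_i(Q)$, $i=1,\dots,r$. A unicity set is a representation set $Q$ for which the representation subject to the conditions $g_i(h_i(x_0))=a_i$, $i=1,\dots,r-1$, is unique for all $f:Q\to\mathbb{R}$, $x_0\in Q$ and $a_i\in\mathbb{R}$. *)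

(* Defs.v *)
From mathcomp Require Import all_boot all_order all_algebra.
From mathcomp Require Import all_classical all_reals.

Set Implicit Arguments.
Unset Strict Implicit.
Unset Printing Implicit Defensive.

Import Order.TTheory GRing.Theory Num.Theory.

Local Open Scope classical_set_scope.
Local Open Scope ring_scope.

(* Functions Q -> R are given by total functions f : X -> R of which only the
   values on Q are ever used; every function on Q is such a restriction. *)

Definition represents (R : realType) (X : Type) (r : nat)
    (h : 'I_r -> X -> R) (Q : set X) (f : X -> R) (g : 'I_r -> R -> R) : Prop :=
  forall x, Q x -> f x = \sum_(i < r) g i (h i x).

Definition representation_set (R : realType) (X : Type) (r : nat)
    (h : 'I_r -> X -> R) (Q : set X) : Prop :=
  forall f : X -> R, exists g : 'I_r -> R -> R, represents h Q f g.

Definition complete_representation_set (R : realType) (X : Type) (r : nat)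
    (h : 'I_r -> X -> R) (Q : set X) : Prop :=
  representation_set h Q /\
  ~ exists P : set X,
      [/\ representation_set h P, P <> Q, Q `<=` P
        & forall i, h i @` P = h i @` Q].

(* The normalization constrains all the g_i but the last one:
   widen_ord (leq_pred r) embeds {0, ..., r-2} into {0, ..., r-1}. *)
Definition normalized_at (R : realType) (X : Type) (r : nat)
    (h : 'I_r -> X -> R) (x0 : X) (a : 'I_r.-1 -> R) (g : 'I_r -> R -> R) :
    Prop :=
  forall i : 'I_r.-1,
    g (widen_ord (leq_pred r) i) (h (widen_ord (leq_pred r) i) x0) = a i.

(* Values of g_i outside h_i(Q) are irrelevant to a representation on Q. *)
Definition unique_normalized_representation (R : realType) (X : Type) (r : nat)
    (h : 'I_r -> X -> R) (Q : set X) (x0 : X) (f : X -> R) (a : 'I_r.-1 -> R) :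
    Prop :=
  forall g g' : 'I_r -> R -> R,
    represents h Q f g -> normalized_at h x0 a g ->
    represents h Q f g' -> normalized_at h x0 a g' ->
    forall (i : 'I_r) (t : R), (h i @` Q) t -> g i t = g' i t.

Definition unicity_set (R : realType) (X : Type) (r : nat)
    (h : 'I_r -> X -> R) (Q : set X) : Prop :=
  representation_set h Q /\
  forall (x0 : X) (f : X -> R) (a : 'I_r.-1 -> R),
    Q x0 -> unique_normalized_representation h Q x0 f a.

(* Main.v *)
(** Two normalized representations of the same function differ by a family d with
    [\sum_i d i (h i x) = 0] on Q and [d i (h i x0) = 0] for all i. If
    [d j t <> 0] for some t in h_j(Q), let x be a point with h_j(x) = t and
    h_i(x) = h_i(x0) for i != j: the sum at x is [d j t <> 0], so x is not
    in Q, and Q can be enlarged by x, the value at x being corrected by a multiple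
    of d. Conversely, if Q has uniqueness and P is a larger representation set
    with the same projections, a representation on P of the indicator of a point
    p outside Q represents 0 on Q, so its summands are constants of sum 0 on
    the sets h_i(Q) and it vanishes at p. *)

Require Import Defs.
From mathcomp Require Import all_boot all_order all_algebra.
From mathcomp Require Import all_classical all_reals.

Set Implicit Arguments.
Unset Strict Implicit.
Unset Printing Implicit Defensive.

Import Order.TTheory GRing.Theory Num.Theory.

Local Open Scope classical_set_scope.
Local Open Scope ring_scope.

Lemma zero_sum_extension (V : zmodType) (n : nat) (b : 'I_n -> V) :
  exists c : 'I_n.+1 -> V,
    \sum_i c i = 0 /\ forall i, c (widen_ord (leq_pred n.+1) i) = b i.
Proof.
pose c (i : 'I_n.+1) :=
  if unlift ord_max i is Some j then b j else - \sum_j b j.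
(* The bound proof [lt_n] is left arbitrary: the statement uses [leq_pred], while [big_ord_recr]
   produces [leqnSn]. *)
have cE i (lt_n : (n <= n.+1)%N) : c (widen_ord lt_n i) = b i.
  suff -> : widen_ord lt_n i = lift ord_max i by rewrite /c liftK.
  by apply: val_inj; rewrite /= /bump leqNgt ltn_ord.
exists c; split=> [|i]; last exact: cE.
rewrite big_ord_recr /= (eq_bigr b) => [|i _]; last exact: cE.
by rewrite /c unlift_none subrr.
Qed.

Lemma ord_widen_or_max (n : nat) (i : 'I_n.+1) :
  (exists j : 'I_n, i = widen_ord (leq_pred n.+1) j) \/ i = ord_max.
Proof.
case: (unliftP ord_max i) => [j ->|->]; [left; exists j | by right].
by apply: val_inj; rewrite /= /bump leqNgt ltn_ord.
Qed.

Section Representations.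
Variables (R : realType) (X : Type) (n : nat) (h : 'I_n.+1 -> X -> R).
Implicit Types (Q : set X) (f : X -> R) (g : 'I_n.+1 -> R -> R).

Lemma representsB Q f f' g g' :
  represents h Q f g -> represents h Q f' g' ->
  represents h Q (fun x => f x - f' x) (fun i t => g i t - g' i t).
Proof. by move=> fg fg' x Qx; rewrite sumrB fg // fg'. Qed.

Lemma representsDZ Q f f' g g' (k : R) :
  represents h Q f g -> represents h Q f' g' ->
  represents h Q (fun x => f x + k * f' x) (fun i t => g i t + k * g' i t).
Proof. by move=> fg fg' x Qx; rewrite big_split -mulr_sumr /= fg // fg'. Qed.

(** Adding constants of sum 0 to the summands keeps the represented function, and all constants but
    the last can be chosen freely. *)
Lemma represents_normalize Q f g x0 (a : 'I_n -> R) :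
  represents h Q f g ->
  exists c : 'I_n.+1 -> R, [/\ \sum_i c i = 0,
    represents h Q f (fun i t => g i t + c i)
    & normalized_at h x0 a (fun i t => g i t + c i)].
Proof.
move=> fg; pose w := widen_ord (leq_pred n.+1).
have [c [c0 cE]] := zero_sum_extension (fun i => a i - g (w i) (h (w i) x0)).
exists c; split=> // [x Qx|i]; first by rewrite big_split /= c0 addr0 fg.
by rewrite cE addrC subrK.
Qed.

(* The normalization fixes the first n values; the value of f at x0 forces the
   last one. *)
Lemma normalized_eq_at Q f x0 (a : 'I_n -> R) g g' :
  Q x0 -> represents h Q f g -> normalized_at h x0 a g ->
  represents h Q f g' -> normalized_at h x0 a g' ->
  forall i, g i (h i x0) = g' i (h i x0).
Proof.
move=> Qx0 fg ag fg' ag'.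
have w i : g (widen_ord (leqnSn n) i) (h (widen_ord (leqnSn n) i) x0) =
           g' (widen_ord (leqnSn n) i) (h (widen_ord (leqnSn n) i) x0).
  have <- : widen_ord (leq_pred n.+1) i = widen_ord (leqnSn n) i
    by apply: val_inj.
  by rewrite ag ag'.
move=> i; case: (ord_widen_or_max i) => [[j ->]|->]; first by rewrite ag ag'.
have := fg _ Qx0; rewrite (fg' _ Qx0) !big_ord_recr /=.
by rewrite (eq_bigr _ (fun i _ => w i)) => /addrI.
Qed.

Lemma unicity_set_complete Q :
  unicity_set h Q -> complete_representation_set h Q.
Proof.
move=> [repQ uniqQ]; split=> // -[P [repP neqPQ subQP hPQ]].
have [p Pp nQp] : exists2 p, P p & ~ Q p.
  apply: contrapT => nex; apply: neqPQ; apply/seteqP; split=> // x Px.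
  by apply: contrapT => nQx; apply: nex; exists x.
have hp i : (h i @` Q) (h i p) by rewrite -hPQ; exists p.
(* At least one [h i] exists, so Q is nonempty and has a base point for the normalization. *)
have [x0 Qx0 _] := hp ord0.
have [g gP] := repP (fun x => if `[< x = p >] then 1 else 0).
have gQ : represents h Q (fun=> 0) g.
  move=> x Qx; rewrite -(gP _ (subQP _ Qx)); case: asboolP => // xp.
  by rewrite xp in Qx.
have [c [c0 cg cn]] := represents_normalize x0 (fun=> 0) gQ.
have zQ : represents h Q (fun=> 0) (fun _ _ => 0) by move=> x _; rewrite big1.
(* Uniqueness is applied against the zero representation, at [h i p], which lies in h_i(Q) although
   p is outside Q. *)
have gE i : g i (h i p) + c i = 0.
  exact: (uniqQ x0 _ (fun=> 0) Qx0 _ _ cg cn zQ).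
have := gP _ Pp; rewrite asboolT // => /eqP.
have -> : \sum_i g i (h i p) = \sum_i (g i (h i p) + c i).
  by rewrite big_split /= c0 addr0.
by rewrite big1 // oner_eq0.
Qed.

Lemma complete_unicity_set Q :
  (forall t : 'I_n.+1 -> R, (forall i, range (h i) (t i)) ->
    exists x : X, forall i, h i x = t i) ->
  complete_representation_set h Q -> unicity_set h Q.
Proof.
move=> h_onto [repQ maxQ]; split=> // x0 f a Qx0 g g' fg ag fg' ag' j t Qt.
apply/eqP; rewrite -subr_eq0; apply/negPn/negP => dt_neq0; apply: maxQ.
pose d i s := g i s - g' i s.
have d0 : represents h Q (fun=> 0) d.
  by move=> x Qx; rewrite -(representsB fg fg' Qx) subrr.
have dx0 i : d i (h i x0) = 0.
  by apply/eqP; rewrite subr_eq0 (normalized_eq_at Qx0 fg ag fg' ag').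
have [i|x hx] := h_onto (fun i => if i == j then t else h i x0).
  by case: eqP => [->|_]; [case: Qt => y _ <-; exists y | exists x0].
have dx : \sum_i d i (h i x) = d j t.
  rewrite (bigD1 j) //= hx eqxx big1 ?addr0 // => i /negPf ij.
  by rewrite hx ij dx0.
exists (Q `|` [set x]); split.
- move=> F; have [G FG] := repQ F.
  (* [k] solves the one equation at x; on Q the multiple of [d] adds 0. *)
  pose k := (F x - \sum_i G i (h i x)) / d j t.
  exists (fun i s => G i s + k * d i s) => y [Qy|->].
    by rewrite -(representsDZ k FG d0 Qy) mulr0 addr0.
  by rewrite big_split -mulr_sumr /= dx divfK // addrC subrK.
- move=> PQ; have Qx : Q x by rewrite -PQ; right.
  by move: dt_neq0; rewrite -/(d j t) -dx -(d0 _ Qx) eqxx.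
- exact: subsetUl.
(* The coordinates of x are t, already in h_j(Q), and values of the [h i] at x0, so no projection
   grows. *)
- move=> i; apply/seteqP; split; last exact: image_subset (@subsetUl _ _ _).
  move=> _ [y [Qy|->] <-]; first by exists y.
  by rewrite hx; case: eqP => [->|_] //; exists x0.
Qed.

Lemma unicity_setP Q :
  unicity_set h Q <->
  forall (x0 : X) (f : X -> R) (a : 'I_n -> R), Q x0 ->
    (exists g, represents h Q f g /\ normalized_at h x0 a g) /\
    unique_normalized_representation h Q x0 f a.
Proof.
split=> [[repQ uniqQ] x0 f a Qx0|H].
  split; last exact: uniqQ.
  have [g fg] := repQ f.
  have [c [_ cg cn]] := represents_normalize x0 a fg.
  by exists (fun i t => g i t + c i).
split=> [f|x0 f a Qx0]; last by case: (H x0 f a Qx0).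
have [[x0 Qx0]|Q0] := pselect (exists x, Q x).
  by have [[g [fg _]] _] := H x0 f (fun=> 0) Qx0; exists g.
(* For empty Q the hypothesis [H] gives nothing, but any family represents vacuously. *)
by exists (fun _ _ => 0) => x Qx; case: Q0; exists x.
Qed.

End Representations.

Theorem theorem4p4 (R : realType) (X : Type) (r : nat) (r_gt0 : (0 < r)%N)
    (h : 'I_r -> X -> R)
    (h_onto : forall t : 'I_r -> R, (forall i, range (h i) (t i)) ->
       exists x : X, forall i, h i x = t i)
    (Q : set X) :
  (complete_representation_set h Q <-> unicity_set h Q) /\
  (complete_representation_set h Q <->
    forall (x0 : X) (f : X -> R) (a : 'I_r.-1 -> R), Q x0 ->
      (exists g : 'I_r -> R -> R,
         represents h Q f g /\ normalized_at h x0 a g) /\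
      unique_normalized_representation h Q x0 f a).
Proof.
case: r r_gt0 h h_onto => // n _ {}h {}h_onto.
have completeP : complete_representation_set h Q <-> unicity_set h Q.
  by split; [exact: complete_unicity_set | exact: unicity_set_complete].
by split=> //; rewrite completeP; exact: unicity_setP.
Qed.
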